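(* (In $\mathsf{ZFC}$.) Any $\trianglelefteq$-basis for the uncountable real orders has at least $\mathfrak{c}^{+}$ elements, where $\mathfrak{c}=2^{\aleph_0}$.
   Context: $B\trianglelefteq A$ means that $B=\varnothing$ or there is an epimorphism from $A$ onto $B$, i.e. a surjective monotone map $f:A\to B$ ($x\le y$ implies $f(x)\le f(y)$). The uncountable real orders are the uncountable subsets of $\mathbb{R}$ with the induced linear order. A $\trianglelefteq$-basis for a class $\mathfrak{C}$ of linear orders is a subset $F$ of $\mathfrak{C}$ such that for every $A\in\mathfrak{C}$ there is $X\in F$ with $X\trianglelefteq A$. *)

(* Defs.v *)
From mathcomp Require Import all_boot all_order all_algebra.
From mathcomp Require Import boolp classical_sets functions cardinality reals.

Set Implicit Arguments.
Unset Strict Implicit.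
Unset Printing Implicit Defensive.

Local Open Scope classical_set_scope.
Local Open Scope card_scope.

(* The linear orders [A] and [B] are subsets of ordered types with the induced
   order. An epimorphism is a total function on the ambient types; only its
   values on [A] matter. *)
Definition epimorphism d d' (T : orderType d) (U : orderType d')
    (A : set T) (B : set U) (f : T -> U) : Prop :=
  {in A &, {homo f : x y / (x <= y)%O}} /\ f @` A = B.

Definition epi_le d d' (T : orderType d) (U : orderType d')
    (B : set U) (A : set T) : Prop :=
  B = set0 \/ exists f : T -> U, epimorphism A B f.

Notation "B ⊴ A" := (epi_le B A) (at level 70, no associativity).

Definition epi_basis d (T : orderType d) (C F : set (set T)) : Prop :=
  F `<=` C /\ forall A, C A -> exists2 X, F X & X ⊴ A.

Definition uncountable_real_orders (R : realType) : set (set R) :=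
  [set A | ~ countable A].

Definition continuum : set (set nat) := [set: set nat].

Definition card_lt T U (A : set T) (B : set U) : Prop :=
  A #<= B /\ ~ (B #<= A).

(* [K] has cardinality |A|^+, the least cardinal greater than |A|. *)
Definition is_card_succ T U (A : set T) (K : set U) : Prop :=
  card_lt A K /\ forall (V : Type) (L : set V), card_lt A L -> K #<= L.

(* |F| >= |A|^+ *)
Definition card_ge_succ T U (A : set T) (F : set U) : Prop :=
  exists (V : Type) (K : set V), is_card_succ A K /\ K #<= F.

(* Main.v *)
Require Import Defs.
From mathcomp Require Import all_boot all_order all_algebra.
From mathcomp Require Import boolp classical_sets functions cardinality reals.
From mathcomp Require wochoice.
From Stdlib Require Inverse_Image.

Import Order.TTheory GRing.Theory Num.Theory.
Local Open Scope classical_set_scope.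
Local Open Scope card_scope.
Local Open Scope ring_scope.

(** Write c for the continuum.  The point is that every family [F] of at most c
    uncountable sets of reals is beaten by a single uncountable set [A] having
    no monotone map onto any member of [F] ([undominated_order]).  A basis
    therefore does not inject into c, and comparability of cardinals turns this
    into c^+ <= |F|.

    To build [A], all monotone maps that could ever be used are captured by
    only c many objects.  A set [S] of pairs of rationals determines a monotone
    relation [curve S] on the reals, and the graph of any monotone map on any
    subset of the line lies inside such a curve ([curve_codeP]).  So there are
    at most c pairs i = (curve [G i], member [X_ i] of [F]) to be defeated.  To
    each one a point [x i] is attached, distinct pairs getting distinct points,
    such that every value of [G i] at [x i] is taken by [G i] nowhere else; the
    set of such points is [unshared (G i)].  Then
      [A := {x i | no value of G i at x i belongs to X_ i}]
    works.  Indeed suppose that [f] maps [A] monotonically onto [X_ i], with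
    graph inside [G i].  If some y in [X_ i] is a value of [G i] at [x i], then
    y = f a for some a in [A], hence a = [x i], as y is not shared; but [x i]
    was kept out of [A].  Otherwise [x i] is in [A], and f ([x i]) is a value of
    [G i] at [x i] that lies in [X_ i], a contradiction.

    Distinct points can be chosen by recursion along a well-order of the pairs
    all of whose proper initial segments are small, provided that every set of
    candidates has c elements ([distinct_representatives],
    [initial_well_order]).  That proviso is where uncountability enters
    ([continuum_le_unshared]): if [G i] contains the graph of a map with
    uncountable range, remove from the line the open intervals on which [G i]
    is constant.  An uncountable closed set remains, so it has c elements by a
    Cantor scheme ([continuum_le_closed]), and all but countably many of them
    are in [unshared (G i)].

    The same recursion lemma yields comparability of cardinals and the
    minimality of c^+, which is realised inside the sets of sets of naturals. *)

(** * Well-orders and cardinals *)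

Lemma set_inj_card_le {T U : Type} (A : set T) (B : set U) (f : T -> U) :
  set_fun A B f -> set_inj A f -> A #<= B.
Proof.
move=> fAB finj.
by have /injfunPex[g] : exists2 f : T -> U, set_fun A B f & set_inj A f;
  [exists f | exact: inj_card_le].
Qed.

(** The point [u0] is what lets an injection defined on [A] become a total
    function. *)
Lemma card_le_set_inj {T U : Type} (u0 : U) (A : set T) (B : set U) :
  A #<= B -> exists2 f : T -> U, set_fun A B f & set_inj A f.
Proof.
elim/Ppointed: U => U in u0 B *; first by have := no u0.
by move=> /pcard_leP/injfunPex.
Qed.

Lemma strict_well_order (T : Type) : exists2 lt : T -> T -> Prop,
  well_founded lt & forall i j, i <> j -> lt i j \/ lt j i.
Proof.
have [R woR] := wochoice.well_ordering_principle {classic T}.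
have minR (A : set T) : A !=set0 -> exists2 z, A z & forall y, A y -> R z y.
  move=> [a Aa].
  have [|z [[Az lbz] _]] := woR (fun x => `[< A x >]).
    by exists a; apply/asboolP.
  by exists z; [exact/asboolP | move=> y Ay; apply: lbz; apply/asboolP].
have Rtot i j : R i j \/ R j i.
  have [|z [->|->] lbz] := minR [set i; j]; first by exists i; left.
    by left; apply: lbz; right.
  by right; apply: lbz; left.
have Ranti i j : R i j -> R j i -> i = j.
  move=> Rij Rji.
  have [|z [_ uz]] := woR (fun x => `[< x = i \/ x = j >]).
    by exists i; apply/asboolP; left.
  have Rii : R i i by case: (Rtot i i).
  have Rjj : R j j by case: (Rtot j j).
  by transitivity z; [symmetry|]; apply: uz; split;
    by [apply/asboolP; auto | move=> x /asboolP[->|->]].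
exists (fun i j => R i j /\ i <> j); last first.
  move=> i j ij; have [Rij|Rji] := Rtot i j; [by left|right].
  by split=> //; apply: nesym.
move=> i; apply: contrapT => nacc.
have [|z nz lbz] := minR [set k | ~ Acc (fun i j => R i j /\ i <> j) k].
  by exists i.
apply: nz; constructor => y [Ryz yz].
by apply: contrapT => /lbz Rzy; apply: yz; apply: Ranti.
Qed.

Lemma wf_min {T : Type} (lt : T -> T -> Prop) (P : set T) : well_founded lt ->
  P !=set0 -> exists2 z, P z & forall y, lt y z -> ~ P y.
Proof.
move=> wf [a]; elim/(well_founded_ind wf): a => a IH Pa.
have [[y [lya Py]]|nex] := pselect (exists y, lt y a /\ P y); first exact: IH Py.
by exists a => // y lya Py; apply: nex; exists y.
Qed.

Definition segment {T : Type} (A : set T) (lt : T -> T -> Prop) (i : T) : set T :=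
  [set j | A j /\ lt j i].

(** By recursion, [x i] is any element of [D i] different from the earlier
    choices.  The recursion can only get stuck at [i] if the earlier choices
    exhaust [D i], and then [D i] injects into the segment below [i]. *)
Lemma distinct_representatives {T U : Type} (u0 : U) (lt : T -> T -> Prop)
    (A : set T) (D : T -> set U) :
  well_founded lt ->
  (forall i j, A i -> A j -> i <> j -> lt i j \/ lt j i) ->
  (forall i, A i -> ~ (D i #<= segment A lt i)) ->
  exists2 x : T -> U, (forall i, A i -> D i (x i)) & set_inj A x.
Proof.
move=> wf tot large.
pose step i (x : forall j, lt j i -> U) : U :=
  @xget {classic U} u0
    [set u | D i u /\ forall j (ji : lt j i), A j -> x j ji <> u].
pose x := Fix wf (fun=> U) step.
have xE i : x i = @xget {classic U} u0
    [set u | D i u /\ forall j, lt j i -> A j -> x j <> u].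
  rewrite /x Fix_eq // => k f g fg; rewrite /step.
  congr (@xget {classic U} u0 _).
  apply/funext => u; apply/propext; split=> -[Du H]; split=> // j ji Aj.
    by rewrite -fg; exact: H.
  by rewrite fg; exact: H.
have xP i : A i -> D i (x i) /\ forall j, lt j i -> A j -> x j <> x i.
  move=> Ai; rewrite (xE i).
  apply: (@xgetPex {classic U} u0 
    [set u | D i u /\ forall j, lt j i -> A j -> x j <> u]); apply: contrapT => none.
  apply: (large i Ai).
  apply: (@card_le_trans _ _ _ (x @` segment A lt i)); last exact: card_image_le.
  apply: subset_card_le => u Du; apply: contrapT => nu; apply: none.
  by exists u; split=> // j ji Aj xju; apply: nu; exists j.
exists x; first by move=> i Ai; have [] := xP i Ai.
move=> i j; rewrite !in_setE => Ai Aj xij.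
apply: contrapT => /tot[] // ltij.
  by have [_ /(_ i ltij Ai)] := xP j Aj.
by have [_ /(_ j ltij Aj)] := xP i Ai; apply; rewrite xij.
Qed.

(** Choose distinct elements of [B] along a well-order of [A]: either this
    succeeds, or [B] is exhausted and injects into a segment of [A]. *)
Lemma card_le_total {T U : Type} (A : set T) (B : set U) : A #<= B \/ B #<= A.
Proof.
have [->|/set0P[b _]] := eqVneq B set0; first by right; exact: card_ge0.
have [lt wf tot] := strict_well_order T.
have [[i Ai Bi]|large] := pselect (exists2 i, A i & B #<= segment A lt i).
  right; apply: card_le_trans Bi _; apply: subset_card_le => j [] //.
left; have [i j _ _ /tot //|i Ai Bi|x xB xinj] :=
  distinct_representatives b lt A (fun=> B) wf.
  by apply: large; exists i.
by apply: set_inj_card_le xinj => i /xB.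
Qed.

(** This amounts to ordering [A] in the type of its cardinal.  If some segment
    of an arbitrary well-order is as large as [A], inject [A] into the least
    such segment and pull the order back. *)
Lemma initial_well_order {T : Type} (A : set T) : exists lt : T -> T -> Prop,
  [/\ well_founded lt,
      forall i j, A i -> A j -> i <> j -> lt i j \/ lt j i &
      forall i, A i -> ~ (A #<= segment A lt i)].
Proof.
have [lt wf tot] := strict_well_order T.
have [[i Ai Asi]|large] := pselect (exists2 i, A i & A #<= segment A lt i);
  last first.
  by exists lt; split=> [//|i j _ _ /tot//|i Ai Asi]; apply: large; exists i.
have [|k [Ak Ask] kmin] := wf_min lt [set i | A i /\ A #<= segment A lt i] wf.
  by exists i.
have [g gk ginj] := card_le_set_inj k _ _ Ask.
exists (fun x y => lt (g x) (g y)); split.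
- by apply: (Inverse_Image.wf_inverse_image T T lt g).
- by move=> x y Ax Ay xy; apply: tot => /ginj; rewrite !in_setE => /(_ Ax Ay).
- move=> y Ay Asy; have [Agy gyk] := gk y Ay.
  apply: (kmin (g y) gyk); split=> //; apply: card_le_trans Asy _.
  apply: (@set_inj_card_le _ _ _ _ g) => [x [Ax xy]|x z].
    by have [] := gk x Ax.
  by rewrite !in_setE => -[Ax _] [Az _]; apply: ginj; rewrite in_setE.
Qed.

Lemma cantor_card (T : Type) : ~ ([set: set T] #<= [set: T]).
Proof.
move=> le; have [t0|noT] := pselect (exists t : T, True); last first.
  have /card_leP[f] := le; apply: noT.
  by exists (val (f (SigSub (mem_set (I : [set: set T] set0))))).
case: t0 => t0 _.
have [f _ finj] := card_le_set_inj t0 _ _ le.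
pose E := [set t | exists2 B, f B = t & ~ B t].
have [EfE|nEfE] := pselect (E (f E)).
  have [B fB] := EfE; apply.
  by rewrite (finj B E) ?in_setE.
by apply: (nEfE); exists E.
Qed.

(** In a well-order of the sets of sets of naturals, [K] is the initial part
    formed by the elements having at most continuum many predecessors.  It does
    not inject into the continuum: otherwise the least element outside it would
    belong to it or, if nothing lies outside, Cantor's theorem would fail.  It
    is the smallest such cardinal because its proper segments are too small to
    exhaust a larger set. *)
Lemma continuum_succ : exists K : set (set (set nat)), is_card_succ continuum K.
Proof.
have [lt wf tot] := strict_well_order (set (set nat)).
pose K := [set i | segment setT lt i #<= continuum].
have seg_le i : K i -> segment K lt i #<= continuum.
  by apply: card_le_trans; apply: subset_card_le => j [_ ?]; split.
have nKA : ~ (K #<= continuum).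
  have [KT|/existsNP[i nKi]] := pselect (forall i, K i).
    rewrite (_ : K = setT); first exact: cantor_card.
    by apply/seteqP; split.
  have [|k nKk kmin] := wf_min lt (~` K) wf; first by exists i.
  move=> KA; apply: nKk; apply: card_le_trans KA.
  by apply: subset_card_le => j [_ /kmin /contrapT].
exists K; split; first by split=> //; have [] := card_le_total continuum K.
move=> V L [_ nLA].
have [L0|/set0P[v _]] := eqVneq L set0.
  by case: nLA; rewrite L0; exact: card_ge0.
have [i j _ _ /tot //|i Ki Li|x xL xinj] :=
  distinct_representatives v lt K (fun=> L) wf.
  by apply: nLA; apply: card_le_trans Li _; exact: seg_le.
by apply: set_inj_card_le xinj => i /xL.
Qed.

(** * Countable sets *)

Lemma subset_countable {T : Type} (A B : set T) :
  A `<=` B -> countable B -> countable A.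
Proof. by move=> AB; apply: card_le_trans; apply: subset_card_le. Qed.

Lemma countableU {T : Type} (A B : set T) :
  countable A -> countable B -> countable (A `|` B).
Proof.
by move=> cA cB; rewrite -bigcup2E; apply: bigcup_countable => // -[|[|n]].
Qed.

Lemma uncountable_nonempty {T : Type} (A : set T) : ~ countable A -> A !=set0.
Proof. by move=> uA; apply/set0P/eqP => A0; apply: uA; rewrite A0. Qed.

Lemma countable_subsingleton {T : Type} (A : set T) :
  (forall x y, A x -> A y -> x = y) -> countable A.
Proof.
move=> A1; apply: (@set_inj_card_le _ _ _ _ (fun=> 0%N)) => //.
by move=> x y; rewrite !in_setE => Ax Ay _; apply: A1.
Qed.

Lemma countable_fibers {I : countType} {T : Type} (V : I -> set T) (A : set T) :
  (forall i x y, V i x -> V i y -> x = y) ->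
  (forall x, A x -> exists i, V i x) -> countable A.
Proof.
move=> V1 AV; apply: (@subset_countable _ _ (\bigcup_i V i)).
  by move=> x /AV[i Vix]; exists i.
by apply: bigcup_countable => // i _; apply: countable_subsingleton; exact: V1.
Qed.

(** * The perfect set theorem on the line *)

Section Reals.
Variable R : realType.
Implicit Types (x y z q a : R) (E H A X : set R).

Lemma rat_between x y : x < y -> exists q : rat, x < ratr q < y.
Proof. by move=> /rat_in_itvoo[q]; rewrite in_itv; exists q. Qed.

(** If every rational leaves only countably many points of [E] on one of its
    sides, discard all those countable parts.  Two remaining points would be
    separated by a rational one of whose sides has been discarded, so at most
    one point remains and [E] is countable. *)
Lemma uncountable_split E : ~ countable E -> exists q,
  ~ countable (E `&` [set x | x < q]) /\ ~ countable (E `&` [set x | q < x]).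
Proof.
move=> uE; apply: contrapT => nosplit; apply: uE.
pose L q := E `&` [set x | x < q]; pose U q := E `&` [set x | q < x].
have LU q : countable (L q) \/ countable (U q).
  by apply: contrapT => /not_orP[nL nU]; apply: nosplit; exists q.
pose C := \bigcup_(q in [set q : rat | countable (L (ratr q))]) L (ratr q) `|`
          \bigcup_(q in [set q : rat | countable (U (ratr q))]) U (ratr q).
have cC : countable C by apply: countableU; apply: bigcup_countable.
apply: (@subset_countable _ _ (C `|` (E `\` C))).
  by move=> x Ex; have [Cx|nCx] := pselect (C x); [left|right].
apply: countableU => //; apply: countable_subsingleton.
suff le x y : (E `\` C) x -> (E `\` C) y -> y <= x.
  by move=> x y Ex Ey; apply/eqP; rewrite eq_le !le.
move=> [Ex nCx] [Ey nCy]; rewrite leNgt; apply/negP.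
move=> /rat_between[q /andP[xq qy]].
have [cL|cU] := LU (ratr q).
  by apply: nCx; left; exists q.
by apply: nCy; right; exists q.
Qed.

(** A pair of reals stands for the closed interval between its components. *)
Definition splits (p : R * R) (c : bool -> R * R) : Prop :=
  [/\ forall i, p.1 <= (c i).1, forall i, (c i).2 <= p.2 &
      (c false).2 < (c true).1].

(** Following a set of naturals, seen as an infinite binary sequence, down the
    tree of intervals gives a nested sequence.  The supremum of the left
    endpoints lies in all the intervals, and it belongs to [H] because the left
    endpoints do: this is how compactness is avoided.  Two branches that
    separate end up in disjoint intervals. *)
Lemma cantor_scheme H (P : R * R -> Prop) :
  (forall E, E `<=` H -> has_sup E -> H (sup E)) ->
  (forall p, P p -> H p.1 /\ p.1 <= p.2) ->
  (forall p, P p -> exists2 c, forall i, P (c i) & splits p c) ->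
  (exists p, P p) -> continuum #<= H.
Proof.
move=> supH PH Psplit [p0 Pp0].
have [next nextP] : exists next : R * R -> bool -> R * R,
    forall p, P p -> (forall i, P (next p i)) /\ splits p (next p).
  have [|next nextP] := @choice (R * R) (bool -> R * R)
    (fun p c => P p -> (forall i, P (c i)) /\ splits p c); last by exists next.
  move=> p; have [/Psplit[c Pc pc]|nPp] := pselect (P p); first by exists c.
  by exists (fun=> p).
pose box (S : set nat) := fix box n :=
  if n is m.+1 then next (box m) `[< S m >] else p0.
have boxP S n : P (box S n).
  by elim: n => //= n /nextP[].
have box1 S m n : (m <= n)%N -> (box S m).1 <= (box S n).1.
  move=> /subnK <-; elim: (n - m)%N => // k IH; apply: le_trans IH _.
  by have [_ [+ _ _]] := nextP _ (boxP S (k + m)%N); exact.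
have box2 S m n : (m <= n)%N -> (box S n).2 <= (box S m).2.
  move=> /subnK <-; elim: (n - m)%N => // k IH; apply: le_trans IH.
  by have [_ [_ + _]] := nextP _ (boxP S (k + m)%N); exact.
have box12 S m n : (box S m).1 <= (box S n).2.
  apply: le_trans (box2 S _ _ (leq_maxr m n)).
  apply: le_trans (box1 S _ _ (leq_maxl m n)) _.
  by have [] := PH _ (boxP S (maxn m n)).
pose x S := sup (range (fun n => (box S n).1)).
have ubx S n : ubound (range (fun n => (box S n).1)) (box S n).2.
  by move=> _ [m _ <-].
have hsx S : has_sup (range (fun n => (box S n).1)).
  by split; [exists (box S 0%N).1, 0%N | exists (box S 0%N).2].
have xbox S n : (box S n).1 <= x S <= (box S n).2.
  apply/andP; split; first by apply: sup_upper_bound => //; exists n.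
  by apply: ge_sup => //; exists (box S 0%N).1, 0%N.
apply: (@set_inj_card_le _ _ _ _ x) => [S _|S S' _ _ xSS'].
  by apply: supH => // _ [n _ <-]; have [] := PH _ (boxP S n).
apply: contrapT => SS'.
have exP : exists n, `[< S n >] != `[< S' n >].
  apply: contrapT => nex; apply: SS'; apply/funext => n; apply/propext.
  have eqS : `[< S n >] = `[< S' n >].
    by apply: contrapT => /eqP ?; apply: nex; exists n.
  by split=> /asboolP; [rewrite eqS|rewrite -eqS] => /asboolP.
case: (ex_minnP exP) => n neq nmin.
have eqbox k : (k <= n)%N -> box S k = box S' k.
  elim: k => // k IH kn /=; rewrite IH ?(ltnW kn) //; congr next.
  by apply/eqP; apply: contraTT kn => /nmin; rewrite -leqNgt.
have [_ [_ _ sep]] := nextP _ (boxP S n).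
have := xbox S n.+1; have := xbox S' n.+1; rewrite /= -(eqbox n) // xSS'.
move: neq sep; case: `[< S n >]; case: `[< S' n >] => // _ sep
  /andP[l1 u1] /andP[l2 u2].
  by have := lt_le_trans sep (le_trans l2 u1); rewrite ltxx.
by have := lt_le_trans sep (le_trans l1 u2); rewrite ltxx.
Qed.

Lemma continuum_le_real : continuum #<= [set: R].
Proof.
apply: (@cantor_scheme _ (fun p => p.1 < p.2)) => //; last by exists (0, 1) => /=.
  by move=> p /ltW.
move=> p /rat_between[q /andP[pq]] /rat_between[r /andP[qr rp]].
exists (fun i => if i then (ratr r, p.2) else (p.1, ratr q)); first by case.
split=> [[]|[]|] //=; first exact: ltW (lt_trans pq qr).
exact: ltW (lt_trans qr rp).
Qed.

(** The left endpoint is kept in [H], so that limits of left endpoints are. *)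
Definition heavy H (p : R * R) : Prop :=
  H p.1 /\ ~ countable (H `&` [set x | p.1 <= x <= p.2]).

(** Split twice, at q < r.  The part below q makes the left interval.  The right
    interval cannot start at q, which may be outside [H]; it starts at a point m
    of [H] between q and r and keeps the part above r. *)
Lemma heavy_split H p : heavy H p ->
  exists2 c, forall i, heavy H (c i) & splits p c.
Proof.
move=> [Hp1 up].
have [q [uL uU]] := uncountable_split _ up.
have [r [uL' uU']] := uncountable_split _ uU.
have [m [[[Hm /andP[pm mp]] /= qm] /= mr]] := uncountable_nonempty _ uL'.
have [l [[_ /andP[pl lp]] /= lq]] := uncountable_nonempty _ uL.
have qp : q <= p.2 by apply: le_trans mp; exact: ltW.
exists (fun i => if i then (m, p.2) else (p.1, q)); last by split=> [[]|[]|].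
case; split=> //=.
- move=> cU; apply: uU'; apply: subset_countable cU.
  move=> x [[[Hx /andP[_ xp]] _] /= rx]; split=> //=.
  by rewrite xp (ltW (lt_trans mr rx)).
- move=> cL; apply: uL; apply: subset_countable cL.
  by move=> x [[Hx /andP[px _]] /= xq]; split=> //=; rewrite px ltW.
Qed.

Lemma heavy_exists H : ~ countable H -> exists p, heavy H p.
Proof.
move=> uH; have [q [uL _]] := uncountable_split _ uH.
have [r [uL' uU']] := uncountable_split _ uL.
have [m [[Hm _] /= mr]] := uncountable_nonempty _ uL'.
exists (m, q); split=> //= cH; apply: uU'; apply: subset_countable cH.
move=> x [[Hx /= xq] /= rx]; split=> //=.
by rewrite (ltW xq) (ltW (lt_trans mr rx)).
Qed.

Lemma continuum_le_closed H :
  (forall E, E `<=` H -> has_sup E -> H (sup E)) -> ~ countable H ->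
  continuum #<= H.
Proof.
move=> supH uH; apply: (@cantor_scheme _ (heavy H)) => //.
- move=> p [Hp /uncountable_nonempty[x [_ /andP[px xp]]]]; split=> //.
  exact: le_trans xp.
- exact: heavy_split.
- exact: heavy_exists.
Qed.

End Reals.

(** * Coding by sets of naturals *)

Lemma card_set_countType (T : countType) : [set: set T] #<= continuum.
Proof.
apply: (@set_inj_card_le _ _ _ _ (fun A : set T => pickle @` A)) => // A B _ _ AB.
have mem_pickle (C : set T) t : (pickle @` C) (pickle t) = C t.
  apply/propext; split=> [[u Cu /(pcan_inj pickleK) <-] //|Ct].
  by exists t.
by apply/funext => t; rewrite -mem_pickle AB mem_pickle.
Qed.

Lemma card_set_sum (T U : Type) :
  [set: set T * set U] #<= [set: set (T + U)].
Proof.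
apply: (@set_inj_card_le _ _ _ _ (fun p : set T * set U =>
  [set z | match z with inl t => p.1 t | inr u => p.2 u end])) => //.
move=> [A B] [A' B'] _ _ /= eqAB; congr pair; apply/funext => t.
  by have := congr1 (fun C => C (inl t)) eqAB.
by have := congr1 (fun C => C (inr t)) eqAB.
Qed.

Lemma card_continuum_pair (T U : countType) :
  [set: set T * set U] #<= continuum.
Proof. exact: card_le_trans (card_set_sum T U) (card_set_countType _). Qed.

(** Split the continuum into continuum many fibres of size continuum.  If each
    fibre met the countable set [C], one point of [C] per fibre would make the
    continuum countable; so some fibre misses [C] altogether. *)
Lemma continuum_setD {T : Type} (H C : set T) :
  continuum #<= H -> countable C -> continuum #<= H `\` C.
Proof.
move=> cH cC.
have [p _ pinj] := card_le_set_inj set0 _ _ (card_continuum_pair nat nat).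
have [h _] : exists h : T, True.
  apply: contrapT => noT; apply: (cantor_card nat).
  apply: card_le_trans cH _; apply: sub_countable cC.
  by apply: subset_card_le => x; case: noT; exists x.
have [g gH ginj] := card_le_set_inj h _ _ cH.
have gp_inj S T1 S' T1' : g (p (S, T1)) = g (p (S', T1')) -> (S, T1) = (S', T1').
  by move=> /ginj; rewrite !in_setE => /(_ I I)/pinj; rewrite !in_setE; exact.
have [|/existsNP[S nS]] := pselect (forall S, exists T1, C (g (p (S, T1)))).
  move=> /choice[t tC]; exfalso; apply: (cantor_card nat).
  apply: card_le_trans cC.
  apply: (@set_inj_card_le _ _ _ _ (fun S => g (p (S, t S)))) => // S S' _ _.
  by move=> /gp_inj[].
apply: (@set_inj_card_le _ _ _ _ (fun T1 => g (p (S, T1)))) => [T1 _|T1 T2 _ _].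
  by split; [exact: gH | move=> CT; apply: nS; exists T1].
by move=> /gp_inj[].
Qed.

(** * Monotone relations *)

Definition monotone_relation {R : realType} (G : R -> R -> Prop) : Prop :=
  forall x x' y y', G x y -> G x' y' -> x < x' -> y <= y'.

(** The interiors of the maximal intervals on which the relation is constant. *)
Definition plateaus {R : realType} (G : R -> R -> Prop) : set R :=
  [set x | exists x1 x2 y, [/\ x1 < x, x < x2, G x1 y & G x2 y]].

Definition unshared {R : realType} (G : R -> R -> Prop) : set R :=
  [set x | forall y x', G x y -> G x' y -> x' = x].

Section MonotoneRelations.
Variables (R : realType) (G : R -> R -> Prop).
Hypothesis monoG : monotone_relation G.

(** A rational lies in the interior of at most one plateau, so it determines the
    level of that plateau. *)
Lemma plateau_levels_countable :
  countable [set y | exists2 x, plateaus G x & G x y].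
Proof.
apply: (@countable_fibers rat _ (fun q => [set y | exists x1 x2,
  [/\ x1 < ratr q, ratr q < x2, G x1 y & G x2 y]])).
  move=> q y y' [x1 [x2 [x1q qx2 G1 G2]]] [x1' [x2' [x1q' qx2' G1' G2']]].
  apply/eqP; rewrite eq_le (monoG _ _ _ _ G1 G2') ?(monoG _ _ _ _ G1' G2) //.
    exact: lt_trans qx2.
  exact: lt_trans qx2'.
move=> y' [x [x1 [x2 [y [x1x xx2 G1 G2]]]] Gx].
have <- : y = y'.
  by apply/eqP; rewrite eq_le (monoG _ _ _ _ G1 Gx) // (monoG _ _ _ _ Gx G2).
have [q /andP[x1q qx2]] := rat_between _ _ _ (lt_trans x1x xx2).
by exists q, x1, x2.
Qed.

(** Outside the interiors of the plateaus a value can only be shared at an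
    endpoint of a plateau.  A rational inside the plateau, together with the
    side on which the endpoint lies, determines this endpoint. *)
Lemma plateau_ends_countable : countable (~` plateaus G `\` unshared G).
Proof.
pose shares_up q x := exists x' y, [/\ x < ratr q, ratr q < x', G x y & G x' y].
pose shares_down q x := exists x' y, [/\ x' < ratr q, ratr q < x, G x y & G x' y].
apply: (@subset_countable _ _
  ([set x | ~ plateaus G x /\ exists q : rat, shares_up q x] `|`
   [set x | ~ plateaus G x /\ exists q : rat, shares_down q x])).
  move=> x [nPx /existsNP[y /existsNP[x' /not_implyP[Gxy /not_implyP[Gx'y]]]]].
  move=> /eqP; rewrite neq_lt => /orP[] /rat_between[q /andP[lq ql]].
    by right; split=> //; exists q, x', y.
  by left; split=> //; exists q, x', y.
apply: countableU.
- apply: (@countable_fibers rat _ (fun q x => ~ plateaus G x /\ shares_up q x)).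
    suff le q x z : ~ plateaus G x /\ shares_up q x ->
        ~ plateaus G z /\ shares_up q z -> x <= z.
      by move=> q x z Hx Hz; apply/eqP; rewrite eq_le !(le q).
    move=> [nPx [x' [y [xq qx' _ _]]]] [nPz [z' [w [zq qz' Gz Gz']]]].
    rewrite leNgt; apply/negP => zx; apply: nPx.
    by exists z, z', w; split=> //; exact: lt_trans qz'.
  by move=> x [nPx [q sq]]; exists q.
- apply: (@countable_fibers rat _ (fun q x => ~ plateaus G x /\ shares_down q x)).
    suff le q x z : ~ plateaus G x /\ shares_down q x ->
        ~ plateaus G z /\ shares_down q z -> z <= x.
      by move=> q x z Hx Hz; apply/eqP; rewrite eq_le !(le q).
    move=> [nPx [x' [y [xq qx' _ _]]]] [nPz [z' [w [zq qz' Gz Gz']]]].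
    rewrite leNgt; apply/negP => zx; apply: nPx.
    by exists z', z, w; split=> //; exact: lt_trans qx'.
  by move=> x [nPx [q sq]]; exists q.
Qed.

(** The union of the plateau interiors is open.  Its complement is therefore
    closed, in the form that the Cantor scheme uses. *)
Lemma plateaus_setC_sup (E : set R) :
  E `<=` ~` plateaus G -> has_sup E -> (~` plateaus G) (sup E).
Proof.
move=> EP [E0 ubE] [x1 [x2 [y [x1s sx2 G1 G2]]]].
have [e Ee x1e] := sup_gt E0 x1s.
apply: (EP e Ee); exists x1, x2, y; split=> //.
by apply: le_lt_trans sx2; apply: ub_le_sup.
Qed.

(** On the plateaus [f] takes countably many values, so it takes uncountably
    many on the complement, which is therefore an uncountable closed set. *)
Lemma continuum_le_unshared (A : set R) (f : R -> R) :
  (forall x, A x -> G x (f x)) -> ~ countable (f @` A) ->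
  continuum #<= unshared G.
Proof.
move=> fG ufA.
have uH : ~ countable (~` plateaus G).
  move=> cH; apply: ufA.
  apply: (@subset_countable _ _ (f @` (~` plateaus G) `|`
                          [set y | exists2 x, plateaus G x & G x y])).
    move=> _ [x Ax <-]; have [Px|nPx] := pselect (plateaus G x); [right|left].
      by exists x => //; exact: fG.
    by exists x.
  apply: countableU plateau_levels_countable.
  exact: card_le_trans (card_image_le _ _) cH.
have cP := continuum_le_closed _ _ plateaus_setC_sup uH.
apply: card_le_trans (continuum_setD _ _ cP plateau_ends_countable) _.
by apply: subset_card_le => x [nPx nD]; apply: contrapT => nUx; apply: nD.
Qed.
End MonotoneRelations.

(** * Curves coded by sets of pairs of rationals *)

(** [S (q, r)] promises that values to the right of [q] are at least [r], and
    its failure that values to the left of [q] are at most [r]. *)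
Definition curve {R : realType} (S : set (rat * rat)) (x y : R) : Prop :=
  forall q r : rat, (S (q, r) -> ratr q < x -> ratr r <= y) /\
                    (~ S (q, r) -> x < ratr q -> y <= ratr r).

Definition curve_code {R : realType} (A : set R) (f : R -> R) : set (rat * rat) :=
  [set p | exists2 x, A x & x <= ratr p.1 /\ ratr p.2 <= f x].

Lemma curve_monotone {R : realType} (S : set (rat * rat)) :
  monotone_relation (@curve R S).
Proof.
move=> x x' y y' Gxy Gx'y' /rat_between[q /andP[xq qx']].
rewrite leNgt; apply/negP => /rat_between[r /andP[y'r ry]].
have [SGx nSGx] := Gxy q r; have [SGx' nSGx'] := Gx'y' q r.
have [Sqr|nSqr] := pselect (S (q, r)).
  by have := lt_le_trans y'r (SGx' Sqr qx'); rewrite ltxx.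
by have := lt_le_trans ry (nSGx nSqr xq); rewrite ltxx.
Qed.

Lemma curve_codeP {R : realType} (A : set R) (f : R -> R) :
  {in A &, {homo f : x y / x <= y}} ->
  forall x, A x -> curve (curve_code A f) x (f x).
Proof.
move=> fhomo x Ax q r; split=> [[/= a Aa [aq rfa]] qx|nS xq].
  apply: le_trans rfa _.
  by apply: fhomo; rewrite ?inE //; apply: ltW; apply: le_lt_trans qx.
rewrite leNgt; apply/negP => rfx; apply: nS; exists x => //=.
by split; exact: ltW.
Qed.

(** The full code promises arbitrarily large values. *)
Lemma curve_setT {R : realType} (x y : R) : ~ curve setT x y.
Proof.
have [q /andP[_ qx]] : exists q : rat, x - 1 < ratr q < x.
  by apply: rat_between; rewrite gtrBl.
have [r /andP[yr _]] : exists r : rat, y < ratr r < y + 1.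
  by apply: rat_between; rewrite ltrDl.
by move=> /(_ q r)[/(_ I qx) ry _]; have := lt_le_trans yr ry; rewrite ltxx.
Qed.

(** * The theorem *)

(** The pairs with code [setT] have an empty curve, hence put their points into
    [A]; there are continuum many of them, which makes [A] uncountable. *)
Lemma undominated_order {R : realType} (F : set (set R)) :
  (forall X, F X -> ~ countable X) -> F #<= continuum ->
  exists2 A : set R, ~ countable A & forall X, F X -> ~ (X ⊴ A).
Proof.
move=> uF cF.
have [h _ hinj] := card_le_set_inj set0 _ _ cF.
(* [X_] sends a set of naturals to the member of [F] that it encodes, if any. *)
have [X_ X_P] : exists X_ : set nat -> set R, forall X, F X -> X_ (h X) = X.
  exists (fun t => xget set0 [set X | F X /\ h X = t]) => X FX.
  apply: xget_unique => // Y [FY hYX].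
  by apply: hinj; rewrite ?in_setE.
pose G (i : set (rat * rat) * set nat) : R -> R -> Prop := curve i.1.
pose I := [set i | continuum #<= unshared (G i)].
have [lt [wf tot small]] := initial_well_order I.
have [i Ii Dis|x xD xinj] :=
  distinct_representatives (0 : R) lt I (fun i => unshared (G i)) wf tot.
  apply: (small i Ii); apply: card_le_trans Dis; apply: card_le_trans Ii.
  apply: card_le_trans (card_continuum_pair _ _); exact: subset_card_le.
pose A := [set x i | i in [set i | I i /\ ~ exists2 y, X_ i.2 y & G i (x i) y]].
have AP i : I i -> A (x i) -> ~ exists2 y, X_ i.2 y & G i (x i) y.
  by move=> Ii [j [Ij nj] /xinj]; rewrite !in_setE => /(_ Ij Ii) <-.
exists A.
  have IT t : I (setT, t).
    apply: card_le_trans (continuum_le_real R) _; apply: subset_card_le => y _.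
    by move=> z x' /curve_setT.
  move=> cA; apply: (cantor_card nat); apply: card_le_trans cA.
  apply: (@set_inj_card_le _ _ _ _ (fun t => x (setT, t))) => [t _|t t' _ _].
    exists (setT, t) => //; split; first exact: IT.
    by move=> [y _ /curve_setT].
  by move=> /xinj; rewrite !in_setE => /(_ (IT t) (IT t'))[].
move=> X FX [X0|[f [fhomo fA]]].
  by apply: (uF X FX); rewrite X0; exact: countable0.
pose i := (curve_code A f, h X).
have fG a : A a -> G i a (f a) by exact: curve_codeP.
have Ii : I i.
  apply: (continuum_le_unshared _ _ (curve_monotone _) _ _ fG).
  by rewrite fA; exact: uF.
have Xi : X_ i.2 = X by exact: X_P.
have [[y Xy Gy]|nex] := pselect (exists2 y, X_ i.2 y & G i (x i) y).
  have [a Aa fay] : (f @` A) y by rewrite fA -Xi.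
  apply: (AP i Ii); last by exists y.
  by rewrite -(xD i Ii y a Gy) // -fay; exact: fG.
have Axi : A (x i) by exists i.
apply: nex; exists (f (x i)); last exact: fG.
by rewrite Xi -fA; exists (x i).
Qed.

Theorem theorem7p3 (R : realType) (F : set (set R))
    (hF : epi_basis (@uncountable_real_orders R) F) :
  card_ge_succ continuum F.
Proof.
have [F_unc F_basis] := hF.
have nFc : ~ (F #<= continuum).
  move=> Fc; have [A uA nA] := undominated_order F F_unc Fc.
  by have [X FX XA] := F_basis A uA; exact: nA XA.
have [K succK] := continuum_succ.
exists _, K; split=> //; apply: succK.2; split=> //.
by have [] := card_le_total continuum F.
Qed.
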